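(* For any bipartite quantum channel $\mathcal N_{AB\to A'B'}$, $\gamma^{\infty}_{\mathrm{PPT}}(\mathcal N)\ge 2^{R^{2\to2}_{\max}(\mathcal N)}$.
   Context: All Hilbert spaces are finite-dimensional; $\log$ is base 2. Alice holds $A$ (input) and $A'$ (output), Bob holds $B$, $B'$. The unnormalized Choi operator of $\mathcal M_{AB\to A'B'}$ is $J^{\mathcal M}_{ABA'B'}=\sum_{i,j}|i\rangle\langle j|_{AB}\otimes\mathcal M(|i\rangle\langle j|_{AB})$. A bipartite channel is PPT if $(J^{\mathcal M}_{ABA'B'})^{T_{BB'}}\ge0$. $\gamma_{\mathrm{PPT}}(\mathcal N)=\inf\{c_1+c_2:\mathcal N=c_1\mathcal M_1-c_2\mathcal M_2,\ c_i\ge0,\ \mathcal M_i\text{ PPT channels}\}$; for $n\ge1$, $\gamma^{(n)}_{\mathrm{PPT}}(\mathcal N)=(\gamma_{\mathrm{PPT}}(\mathcal N^{\otimes n}))^{1/n}$ with PPT taken with respect to Alice $(A^n,A'^n)$ : Bob $(B^n,B'^n)$, and $\gamma^{\infty}_{\mathrm{PPT}}(\mathcal N)=\lim_{n\to\infty}\gamma^{(n)}_{\mathrm{PPT}}(\mathcal N)$. The bidirectional max-Rains information is $R^{2\to2}_{\max}(\mathcal N)=\log\Gamma^{2\to2}(\mathcal N)$, where $\Gamma^{2\to2}(\mathcal N)=\inf\{\|\mathrm{tr}_{A'B'}(V_{ABA'B'}+Y_{ABA'B'})\|_\infty:\ V,Y\ge0,\ (V-Y)^{T_{BB'}}\ge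 J^{\mathcal N}_{ABA'B'}\}$. *)

(* Defs.v *)
From HB Require Import structures.
From mathcomp Require Import all_boot all_order all_algebra.
From mathcomp Require Import complex.
From mathcomp Require Import all_classical all_reals all_analysis.

Set Implicit Arguments.
Unset Strict Implicit.
Unset Printing Implicit Defensive.

Import Order.TTheory GRing.Theory Num.Theory.
Import numFieldTopology.Exports numFieldNormedType.Exports.
Local Open Scope ring_scope.
Local Open Scope classical_set_scope.

Section QuantumDefs.
Variable R : realType.
Local Notation C := R[i].

(* Operators on the Hilbert space C^T (T a finite basis), as matrices indexed by T *)
Definition op (T : finType) := T -> T -> C.

Definition lmap (T U : finType) := op T -> op U.

Definition is_linear (T U : finType) (f : lmap T U) : Prop :=
  forall (a : C) (X Y : op T) (i j : U),
    f (fun k l => a * X k l + Y k l) i j = a * f X i j + f Y i j.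

Definition Eij (T : finType) (i j : T) : op T :=
  fun k l => ((k == i) && (l == j))%:R.

Definition trace (T : finType) (X : op T) : C := \sum_(i : T) X i i.

(* positive semidefinite: <v, X v> >= 0 for every vector v (over C this
   includes hermiticity) *)
Definition psd (T : finType) (X : op T) : Prop :=
  forall v : T -> C, 0 <= \sum_(i : T) \sum_(j : T) Num.conj (v i) * X i j * v j.

Definition opsub (T : finType) (X Y : op T) : op T := fun i j => X i j - Y i j.
Definition opadd (T : finType) (X Y : op T) : op T := fun i j => X i j + Y i j.

Definition tensor_id (Rn T U : finType) (f : lmap T U) : lmap (Rn * T)%type (Rn * U)%type :=
  fun X p q => \sum_(i : T) \sum_(j : T) X (p.1, i) (q.1, j) * f (Eij i j) p.2 q.2.

Definition completely_positive (T U : finType) (f : lmap T U) : Prop :=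
  forall (Rn : finType) (X : op (Rn * T)%type), psd X -> psd (@tensor_id Rn T U f X).

Definition trace_preserving (T U : finType) (f : lmap T U) : Prop :=
  forall X : op T, trace (f X) = trace X.

Definition channel (T U : finType) (f : lmap T U) : Prop :=
  [/\ is_linear f, completely_positive f & trace_preserving f].

(* unnormalized Choi operator J_{T U} = sum_{i,j} |i><j| (x) f(|i><j|) *)
Definition choi (T U : finType) (f : lmap T U) : op (T * U)%type :=
  fun p q => f (Eij p.1 q.1) p.2 q.2.

Definition ptBB' (A B A' B' : finType) (X : op ((A * B) * (A' * B'))%type) :
  op ((A * B) * (A' * B'))%type :=
  fun p q => X ((p.1.1, q.1.2), (p.2.1, q.2.2)) ((q.1.1, p.1.2), (q.2.1, p.2.2)).

Definition ppt_channel (A B A' B' : finType) (f : lmap (A * B)%type (A' * B')%type) : Prop :=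
  channel f /\ psd (ptBB' (choi f)).

Definition tpow (A B A' B' : finType) (n : nat) (f : lmap (A * B)%type (A' * B')%type) :
  lmap (n.-tuple A * n.-tuple B)%type (n.-tuple A' * n.-tuple B')%type :=
  fun X p q => \sum_(i : (n.-tuple A * n.-tuple B)%type) \sum_(j : (n.-tuple A * n.-tuple B)%type)
     X i j * \prod_(k < n)
        f (Eij (tnth i.1 k, tnth i.2 k) (tnth j.1 k, tnth j.2 k))
          (tnth p.1 k, tnth p.2 k) (tnth q.1 k, tnth q.2 k).

Arguments tpow [A B A' B'] n f _ _ _.

Definition gamma_PPT (A B A' B' : finType) (N : lmap (A * B)%type (A' * B')%type) : R :=
  inf [set t : R | exists (c1 c2 : R) (M1 M2 : lmap (A * B)%type (A' * B')%type),
        [/\ 0 <= c1 /\ 0 <= c2, ppt_channel M1, ppt_channel M2,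
            (forall X i j, N X i j = (c1%:C)%C * M1 X i j - (c2%:C)%C * M2 X i j)
          & t = c1 + c2]].

Definition gamma_PPT_n (A B A' B' : finType) (N : lmap (A * B)%type (A' * B')%type) (n : nat) : R :=
  gamma_PPT (tpow n N) `^ (n%:R)^-1.

Definition gamma_PPT_inf (A B A' B' : finType) (N : lmap (A * B)%type (A' * B')%type) : R :=
  limn (fun n : nat => gamma_PPT_n N n.+1).

Definition cmod (z : C) : R := complex.Re `|z|.

Definition opnorm (T : finType) (X : op T) : R :=
  sup [set t : R | exists v : T -> C,
        \sum_(i : T) cmod (v i) ^+ 2 = 1 /\
        t = Num.sqrt (\sum_(i : T) cmod (\sum_(j : T) X i j * v j) ^+ 2)].

Definition ptrace2 (T U : finType) (X : op (T * U)%type) : op T :=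
  fun i j => \sum_(k : U) X (i, k) (j, k).

Definition Gamma22 (A B A' B' : finType) (N : lmap (A * B)%type (A' * B')%type) : R :=
  inf [set t : R | exists V Y : op ((A * B) * (A' * B'))%type,
        [/\ psd V, psd Y, psd (opsub (ptBB' (opsub V Y)) (choi N))
          & t = opnorm (ptrace2 (opadd V Y))]].

Definition Rmax22 (A B A' B' : finType) (N : lmap (A * B)%type (A' * B')%type) : R :=
  ln (Gamma22 N) / ln 2.

End QuantumDefs.

(* Main.v *)
(** The max-Rains quantity of [N] is a semidefinite program in the Choi operator
[J]. A Hahn-Banach argument produces an optimal dual solution: operators [X]
and [rho] with [tr rho = 1], [- rho (x) 1 <= X^T_BB' <= rho (x) 1] and
[tr (X J) = D >= Gamma22 N]. Dual feasibility is inherited by tensor powers,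
because [-P <= Q <= P] is preserved by tensor products, and the dual value is
then [D ^ n]. Pairing the dual solution with a decomposition
[N^(x)n = c1 M1 - c2 M2] gives [D ^ n <= c1 + c2], since a PPT channel pairs to
at most [tr rho^(x)n = 1] in absolute value. Hence [gamma (N^(x)n) ^ (1/n) >= D]
for every [n], and the limit exists by Fekete's lemma because products of
decompositions make [gamma] submultiplicative.

Traces of products are replaced by the bilinear pairing [sum_ij X_ij Y_ij],
that is [tr (X Y^T)], and tensor products by Schur products of pullbacks along
index maps, so that the Schur product theorem is the only positivity result
needed. *)

Require Import Defs.
From HB Require Import structures.
From mathcomp Require Import all_boot all_order all_algebra.
From mathcomp Require Import complex.
From mathcomp Require Import all_classical all_reals all_analysis.
From mathcomp Require Import ring lra.
Import Order.TTheory GRing.Theory Num.Theory.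
Import numFieldTopology.Exports numFieldNormedType.Exports.
Local Open Scope ring_scope.

Set Implicit Arguments.
Unset Strict Implicit.

(** * Positive semidefinite operators *)

Section PositiveSemidefinite.
Variable R : realType.
Local Notation C := R[i].
Implicit Types T K : finType.

Lemma op_ext T (X Y : op R T) : (forall i j, X i j = Y i j) -> X = Y.
Proof. by move=> XY; apply: funext => i; apply: funext => j. Qed.

Lemma sum_delta (S : pzSemiRingType) T (a : T) (F : T -> S) :
  \sum_i (i == a)%:R * F i = F a.
Proof.
rewrite (bigD1 a) //= eqxx mul1r big1 ?addr0 // => i /negPf ->.
by rewrite mul0r.
Qed.

Lemma sum_delta_r (S : pzSemiRingType) T (a : T) (F : T -> S) :
  \sum_i F i * (i == a)%:R = F a.
Proof.
rewrite (bigD1 a) //= eqxx mulr1 big1 ?addr0 // => i /negPf ->.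
by rewrite mulr0.
Qed.

Lemma sum_pair (V : nmodType) T K (F : T * K -> V) :
  \sum_p F p = \sum_i \sum_k F (i, k).
Proof. by rewrite pair_bigA; apply: eq_bigr => -[]. Qed.

Definition pairing T (X Y : op R T) : C := \sum_i \sum_j X i j * Y i j.

Definition schur T (X Y : op R T) : op R T := fun i j => X i j * Y i j.

Definition pullback T K (g : K -> T) (X : op R T) : op R K :=
  fun k l => X (g k) (g l).

Definition delta T : op R T := fun i j => (i == j)%:R.
Arguments delta {T}.

Definition opscale T (a : C) (X : op R T) : op R T := fun i j => a * X i j.

(** The conjugate sits on the left, the transpose of the usual w w^*, so that the bilinear [pairing]
    of [X] with [rank1 v] is the quadratic form <v, X v>. *)
Definition rank1 T (w : T -> C) : op R T := fun i j => Num.conj (w i) * w j.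

(** The quadratic form of B^* X B at [v] is that of [X] at [B v]. *)
Lemma psd_compress T K (B : T -> K -> C) (X : op R T) : psd X ->
  psd (fun k l => \sum_i \sum_j Num.conj (B i k) * X i j * B j l).
Proof.
move=> psdX v; move: (psdX (fun i => \sum_k B i k * v k)).
congr (0 <= _).
under [LHS]eq_bigr => i _.
  under eq_bigr => j _.
    rewrite rmorph_sum /= big_distrl big_distrl /=.
    under eq_bigr => k _ do rewrite big_distrr /=.
    over.
  rewrite exchange_big /=.
  under eq_bigr => k _ do rewrite exchange_big /=.
  over.
rewrite exchange_big /=; apply: eq_bigr => k _.
rewrite exchange_big /=; apply: eq_bigr => l _.
rewrite big_distrr big_distrl /=; apply: eq_bigr => i _.
rewrite big_distrr big_distrl /=; apply: eq_bigr => j _.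
rewrite rmorphM /=; ring.
Qed.

Lemma psd_pullback T K (g : K -> T) (X : op R T) : psd X -> psd (pullback g X).
Proof.
move=> /(@psd_compress T K (fun i k => (i == g k)%:R)).
congr psd; apply: op_ext => k l; rewrite /pullback.
under eq_bigr => i _.
  under eq_bigr => j _ do rewrite conjC_nat.
  rewrite sum_delta_r; over.
by rewrite sum_delta.
Qed.

Lemma psd_partial_sum T K (X : op R (K * T)%type) :
  psd X -> psd (fun k l => \sum_i \sum_j X (k, i) (l, j)).
Proof.
move=> psdX v; move: (psdX (fun p => v p.1)); congr (0 <= _).
rewrite sum_pair; apply: eq_bigr => k _.
under eq_bigr => i _ do rewrite sum_pair /=.
rewrite exchange_big /=; apply: eq_bigr => l _.
rewrite big_distrr big_distrl /=; apply: eq_bigr => i _.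
by rewrite big_distrr big_distrl /=.
Qed.

Lemma psd_add T (X Y : op R T) : psd X -> psd Y -> psd (opadd X Y).
Proof.
move=> psdX psdY v; move: (addr_ge0 (psdX v) (psdY v)); congr (0 <= _).
rewrite -big_split /=; apply: eq_bigr => i _.
rewrite -big_split /=; apply: eq_bigr => j _.
by rewrite /opadd mulrDr mulrDl.
Qed.

Lemma psd_scale T (a : C) (X : op R T) : 0 <= a -> psd X -> psd (opscale a X).
Proof.
move=> a_ge0 psdX v; move: (mulr_ge0 a_ge0 (psdX v)); congr (0 <= _).
rewrite big_distrr /=; apply: eq_bigr => i _.
rewrite big_distrr /=; apply: eq_bigr => j _.
by rewrite /opscale; ring.
Qed.

Lemma psd0 T : psd (fun _ _ : T => 0 : C).
Proof.
by move=> v; rewrite big1 // => i _; rewrite big1 // => j _; rewrite mulr0 mul0r.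
Qed.

Lemma psd_rank1 T (w : T -> C) : psd (rank1 w).
Proof.
move=> v; rewrite [leRHS](_ : _ = `|\sum_j w j * v j| ^+ 2) ?exprn_ge0//.
rewrite normCK rmorph_sum mulrC big_distrl /=; apply: eq_bigr => i _.
rewrite big_distrr /=; apply: eq_bigr => j _.
by rewrite rmorphM /= /rank1; ring.
Qed.

Lemma psd_all_ones T : psd (fun _ _ : T => 1 : C).
Proof.
move: (psd_rank1 (fun _ : T => 1)); congr psd; apply: op_ext => i j.
by rewrite /rank1 conjC1 mulr1.
Qed.

Lemma psd_delta T : psd (@delta T).
Proof.
move=> v; apply: sumr_ge0 => i _.
rewrite (bigD1 i) //= big1 ?addr0 => [|j /negPf ji].
  by rewrite /delta eqxx mulr1 mulrC mul_conjC_ge0.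
by rewrite /delta eq_sym ji mulr0 mul0r.
Qed.

(** Pulling back along a map from [bool] extracts a principal 2x2 submatrix; [i = j] is allowed. *)
Lemma psd_2x2 T (X : op R T) i j (a b : C) : psd X ->
  0 <= Num.conj a * X i i * a + Num.conj a * X i j * b
     + Num.conj b * X j i * a + Num.conj b * X j j * b.
Proof.
move=> psdX.
have := psd_pullback (fun t : bool => if t then i else j) psdX
  (fun t : bool => if t then a else b).
by rewrite !big_bool /pullback /= addrA.
Qed.

Lemma psd_diag_ge0 T (X : op R T) i : psd X -> 0 <= X i i.
Proof.
move=> /(@psd_2x2 _ X i i 1 0).
by rewrite conjC0 conjC1 !mulr0 !mul0r !addr0 mul1r mulr1.
Qed.

Lemma psd_herm T (X : op R T) i j : psd X -> Num.conj (X i j) = X j i.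
Proof.
move=> psdX.
have xi := psd_diag_ge0 i psdX; have xj := psd_diag_ge0 j psdX.
(* The form is real at (1, 1), which makes the imaginary parts of [X i j] and [X j i] opposite, and
   at (1, i), which makes their real parts equal. *)
have := psd_2x2 i j 1 1 psdX; have := psd_2x2 i j 1 'i%C psdX.
have ci : Num.conj ('i%C : C) = - 'i%C by rewrite /=; simpc.
rewrite ci conjC1; move: xi xj.
case: (X i i) (X i j) (X j i) (X j j) => [a a'] [b b'] [c c'] [d d'].
rewrite /= ; simpc => /andP[/eqP -> _] /andP[/eqP -> _] /andP[/eqP h1 _] /andP[/eqP h2 _].
congr (_ +i* _)%C; lra.
Qed.

End PositiveSemidefinite.
Arguments delta {R T}.

(** * The Schur product theorem and operator domination *)

Section SchurProduct.
Variable R : realType.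
Local Notation C := R[i].
Implicit Types T K : finType.

Lemma psd_schur_rank1 T (w : T -> C) (Y : op R T) :
  psd Y -> psd (schur (rank1 w) Y).
Proof.
move=> psdY v; move: (psdY (fun i => w i * v i)); congr (0 <= _).
apply: eq_bigr => i _; apply: eq_bigr => j _.
by rewrite rmorphM /= /schur /rank1; ring.
Qed.

(** Compression of [X] by the map sending the basis vector e_k to e_k - (X_ik / X_ii) e_i. *)
Lemma psd_schur_complement T (X : op R T) i : psd X -> X i i != 0 ->
  psd (fun k l => X k l - X k i * X i l / X i i).
Proof.
move=> psdX xi0.
have := psd_compress (fun j k => (j == k)%:R - (j == i)%:R * (X i k / X i i)) psdX.
congr psd; apply: op_ext => k l.
have inner j : \sum_m X j m * ((m == l)%:R - (m == i)%:R * (X i l / X i i))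
    = X j l - X j i * (X i l / X i i).
  set c := _ / _; under eq_bigr => m _ do rewrite mulrBr [X in _ - X]mulrA.
  by rewrite sumrB -mulr_suml !sum_delta_r.
under eq_bigr => j _.
  under eq_bigr => m _ do rewrite -mulrA.
  rewrite -big_distrr /= inner rmorphB rmorphM fmorph_div /= !conjC_nat.
  rewrite !(psd_herm _ _ psdX) mulrBl -mulrA; over.
by rewrite sumrB !sum_delta [X i i * _]mulrC divfK // subrr mulr0 subr0 mulrA.
Qed.

Lemma psd_zero_row T (X : op R T) i j : psd X -> X i i = 0 -> X i j = 0.
Proof.
move=> psdX xi0; apply/eqP; apply: contraT => xij0.
have d_ge0 := psd_diag_ge0 j psdX.
(* Since X_ii = 0, this coefficient makes each cross term equal to -(X_jj + 1), so the form takes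
   the negative value -(X_jj + 2). *)
have := psd_2x2 i j (- (X j j + 1) / X j i) 1 psdX.
have xji0 : X j i != 0 by rewrite -(psd_herm i j psdX) conjC_eq0.
rewrite xi0 mulr0 mul0r add0r conjC1 !mul1r !mulr1.
rewrite fmorph_div rmorphN rmorphD rmorph1 /= !(psd_herm _ _ psdX).
rewrite [X j i * _]mulrC !divfK //.
rewrite (_ : _ + _ = - (X j j + 2)); last by ring.
by rewrite oppr_ge0 lt_geF // ltr_wpDl.
Qed.

(* Each Schur complement at a nonzero diagonal entry splits off a rank-one
   term and shrinks the support of the remaining matrix. *)
Lemma psd_schur T (X Y : op R T) : psd X -> psd Y -> psd (schur X Y).
Proof.
move=> psdX psdY.
suff schur_supp (s : seq T) (Z : op R T) : psd Z ->
    (forall i, i \notin s -> forall j, Z i j = 0) -> psd (schur Z Y).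
  by apply: (schur_supp (enum T)) => // i; rewrite mem_enum.
elim: s Z => [|i s IHs] Z psdZ suppZ.
  move: (@psd0 R T); congr psd; apply: op_ext => i j.
  by rewrite /schur suppZ // mul0r.
have [zi0|zi0] := eqVneq (Z i i) 0.
  apply: IHs => // j js k; have [->|ji] := eqVneq j i.
    exact: psd_zero_row.
  by apply: suppZ; rewrite inE negb_or ji.
have zi_ge0 := psd_diag_ge0 i psdZ.
have psdZ' : psd (schur (fun k l => Z k l - Z k i * Z i l / Z i i) Y).
  apply: IHs => [|j js k]; first exact: psd_schur_complement.
  have [->|ji] := eqVneq j i; first by rewrite mulrAC mulfV // mul1r subrr.
  have zj0 m : Z j m = 0 by apply: suppZ; rewrite inE negb_or ji.
  by rewrite !zj0 !mul0r subrr.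
have := psd_add psdZ' (psd_scale (a := (Z i i)^-1) _ (psd_schur_rank1 (Z i) psdY)).
rewrite invr_ge0 => /(_ zi_ge0); congr psd; apply: op_ext => k l.
rewrite /opadd /opscale /schur /rank1 (psd_herm _ _ psdZ); ring.
Qed.

(** The pairing is the quadratic form of the Schur product at the all-ones vector. *)
Lemma pairing_ge0 T (X Y : op R T) : psd X -> psd Y -> 0 <= pairing X Y.
Proof.
move=> psdX psdY; move: (psd_schur psdX psdY (fun=> 1)); congr (0 <= _).
apply: eq_bigr => i _; apply: eq_bigr => j _.
by rewrite conjC1 mul1r mulr1.
Qed.

Lemma pairingC T (X Y : op R T) : pairing X Y = pairing Y X.
Proof. by apply: eq_bigr => i _; apply: eq_bigr => j _; rewrite mulrC. Qed.

Lemma pairingDr T (X Y Z : op R T) :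
  pairing X (opadd Y Z) = pairing X Y + pairing X Z.
Proof.
rewrite -big_split; apply: eq_bigr => i _ /=.
by rewrite -big_split; apply: eq_bigr => j _ /=; rewrite mulrDr.
Qed.

Lemma pairingZr T a (X Y : op R T) : pairing X (opscale a Y) = a * pairing X Y.
Proof.
rewrite big_distrr; apply: eq_bigr => i _ /=.
by rewrite big_distrr; apply: eq_bigr => j _ /=; rewrite mulrCA.
Qed.

Lemma opsubE T (X Y : op R T) : opsub X Y = opadd X (opscale (- 1) Y).
Proof. by apply: op_ext => i j; rewrite /opadd /opscale mulN1r. Qed.

Lemma pairingBr T (X Y Z : op R T) :
  pairing X (opsub Y Z) = pairing X Y - pairing X Z.
Proof. by rewrite opsubE pairingDr pairingZr mulN1r. Qed.

Lemma pairing_rank1 T (X : op R T) (v : T -> C) :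
  pairing X (rank1 v) = \sum_i \sum_j Num.conj (v i) * X i j * v j.
Proof.
by apply: eq_bigr => i _; apply: eq_bigr => j _; rewrite /rank1; ring.
Qed.

Lemma pairing_delta T (X : op R T) : pairing X (@delta R T) = trace X.
Proof.
apply: eq_bigr => i _.
by under eq_bigr => j _ do rewrite /delta eq_sym; rewrite sum_delta_r.
Qed.

Definition dominated T (Q P : op R T) := psd (opadd P Q) /\ psd (opsub P Q).

(** With o for the Schur product, (P + Q) o (P' + Q') + (P - Q) o (P' - Q') = 2 (P o P' + Q o Q'),
    and the two mixed products sum to 2 (P o P' - Q o Q'). *)
Lemma dominated_schur T (Q P Q' P' : op R T) :
  dominated Q P -> dominated Q' P' -> dominated (schur Q Q') (schur P P').
Proof.
move=> [a b] [a' b'].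
have half_ge0 : 0 <= 2^-1 :> C by rewrite invr_ge0.
split.
- have := psd_scale half_ge0 (psd_add (psd_schur a a') (psd_schur b b')).
  congr psd; apply: op_ext => i j.
  by rewrite /opscale /opadd /opsub /schur; field.
- have := psd_scale half_ge0 (psd_add (psd_schur a b') (psd_schur b a')).
  congr psd; apply: op_ext => i j.
  by rewrite /opscale /opadd /opsub /schur; field.
Qed.

Lemma dominated_pairing T (Q P X : op R T) : dominated Q P -> psd X ->
  pairing Q X <= pairing P X /\ - pairing Q X <= pairing P X.
Proof.
move=> [a b] psdX; split; rewrite -subr_ge0.
  by move: (pairing_ge0 psdX b); rewrite pairingBr ![pairing X _]pairingC.
rewrite opprK.
by move: (pairing_ge0 psdX a); rewrite pairingDr ![pairing X _]pairingC.
Qed.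

Lemma dominated_pullback T K (g : K -> T) (Q P : op R T) :
  dominated Q P -> dominated (pullback g Q) (pullback g P).
Proof. by move=> [/(psd_pullback g) a /(psd_pullback g) b]. Qed.

End SchurProduct.

(** * Operator inequalities and the operator norm *)

Section OperatorBounds.
Variable R : realType.
Local Notation C := R[i].
Implicit Types T K : finType.

Lemma cmodE (z : C) : ((cmod z)%:C)%C = `|z|.
Proof. by case: z. Qed.

Lemma ge0_ReE (z : C) : 0 <= z -> ((complex.Re z)%:C)%C = z.
Proof. by move=> z_ge0; rewrite RRe_real // ger0_real. Qed.

Lemma sum_cmod_sqr T (v : T -> C) :
  (((\sum_i cmod (v i) ^+ 2)%:C)%C : C) = \sum_i Num.conj (v i) * v i.
Proof.
rewrite rmorph_sum; apply: eq_bigr => i _ /=.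
by rewrite rmorphXn /= cmodE normCK mulrC.
Qed.

Lemma qf_scaled_sub T (M : op R T) s (v : T -> C) :
  \sum_i \sum_j Num.conj (v i) * opsub (opscale s (@delta R T)) M i j * v j
    = s * (\sum_i Num.conj (v i) * v i)
      - \sum_i \sum_j Num.conj (v i) * M i j * v j.
Proof.
rewrite big_distrr -sumrB; apply: eq_bigr => i _ /=.
rewrite mulrA -(@sum_delta_r _ _ i (fun j => s * Num.conj (v i) * v j)) -sumrB.
by apply: eq_bigr => j _; rewrite /opsub /opscale /delta eq_sym; ring.
Qed.

Lemma psd_bounded_qf T (M : op R T) s (v : T -> C) :
  psd (opsub (opscale s (@delta R T)) M) ->
  \sum_i \sum_j Num.conj (v i) * M i j * v j
    <= s * \sum_i Num.conj (v i) * v i.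
Proof.
by move=> /(_ v); rewrite qf_scaled_sub subr_ge0.
Qed.

(* With [w = M v], positivity of [M] at [s v - w] gives
   [2 s |w|^2 <= s^2 <v, M v> + <w, M w>]; then use [M <= s] twice. *)
Lemma psd_bounded_norm T (M : op R T) (s : R) (v : T -> C) : 0 < s ->
  psd M -> psd (opsub (opscale (s%:C)%C (@delta R T)) M) ->
  \sum_i cmod (\sum_j M i j * v j) ^+ 2 <= s ^+ 2 * \sum_i cmod (v i) ^+ 2.
Proof.
move=> s_gt0 psdM leM; pose w i := \sum_j M i j * v j.
rewrite -lecR rmorphM /= rmorphXn /= !sum_cmod_sqr -/w.
set S : C := (s%:C)%C; have S_gt0 : 0 < S by rewrite ltcR.
have qv := psd_bounded_qf v leM; have qw := psd_bounded_qf w leM.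
have := psdM (fun i => S * v i - w i).
have cS : Num.conj S = S by rewrite conj_Creal // gtr0_real.
have wv : \sum_i \sum_j Num.conj (w i) * M i j * v j
        = \sum_i Num.conj (w i) * w i.
  by apply: eq_bigr => i _; rewrite /w big_distrr; apply: eq_bigr => j _ /=; rewrite mulrA.
have vw : \sum_i \sum_j Num.conj (v i) * M i j * w j
        = \sum_i Num.conj (w i) * w i.
  rewrite exchange_big; apply: eq_bigr => j _ /=.
  rewrite {2}/w rmorph_sum big_distrl; apply: eq_bigr => i _ /=.
  by rewrite rmorphM /= (psd_herm _ _ psdM); ring.
move: qv qw wv vw.
set q_v := \sum_i \sum_j Num.conj (v i) * M i j * v j.
set q_w := \sum_i \sum_j Num.conj (w i) * M i j * w j.
set n_w := \sum_i Num.conj (w i) * w i.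
set n_v := \sum_i Num.conj (v i) * v i.
move=> qv qw wv vw.
rewrite (_ : \sum_i _ = S ^+ 2 * q_v - S * n_w - S * n_w + q_w); last first.
  rewrite -[in X in _ - X - _]vw -[in X in _ - _ - X]wv !big_distrr -!sumrB -big_split.
  apply: eq_bigr => i _ /=.
  rewrite !big_distrr -!sumrB -big_split; apply: eq_bigr => j _ /=.
  by rewrite rmorphB rmorphM /= cS; ring.
move=> pos.
have h1 : S * n_w <= S ^+ 2 * q_v.
  have : S * n_w + (S * n_w - q_w) <= S ^+ 2 * q_v.
    by rewrite -subr_ge0; move: pos; congr (0 <= _); ring.
  by apply: le_trans; rewrite lerDl subr_ge0.
have h2 : S * n_w <= S ^+ 2 * (S * n_v).
  by apply: le_trans h1 _; rewrite ler_wpM2l // exprn_ge0 // ltW.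
by rewrite mulrCA in h2; rewrite ler_pM2l in h2.
Qed.

Lemma opnorm_le T (M : op R T) (s : R) : (0 < #|T|)%N ->
  psd M -> psd (opsub (opscale (s%:C)%C (@delta R T)) M) -> opnorm M <= s.
Proof.
move=> /card_gt0P[i0 _] psdM leM.
(* [psd_bounded_norm] asks for a positive bound while [s] may be 0, hence the slack [e]. *)
apply/ler_addgt0Pr => e e_gt0.
have s_ge0 : 0 <= s.
  have := addr_ge0 (psd_diag_ge0 i0 leM) (psd_diag_ge0 i0 psdM).
  by rewrite /opsub /opscale /delta eqxx mulr1 subrK lecR.
have se_gt0 : 0 < s + e by rewrite ltr_wpDl.
apply: ge_sup.
  eexists; exists (fun i => (i == i0)%:R); split; last by [].
  rewrite (bigD1 i0) //= eqxx big1 ?addr0 => [|i /negPf ->].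
    by rewrite /cmod normr1 expr1n.
  by rewrite /cmod normr0 expr0n.
move=> _ [v [v1 ->]].
rewrite -(gtr0_norm se_gt0) -sqrtr_sqr ler_sqrt ?sqr_ge0 //.
rewrite -[leRHS]mulr1 -v1; apply: psd_bounded_norm => //.
have e_ge0 : 0 <= (e%:C)%C :> C by rewrite lecR ltW.
have := psd_add leM (psd_scale e_ge0 (@psd_delta R T)).
congr psd; apply: op_ext => i j.
rewrite /opadd /opsub /opscale rmorphD /=; ring.
Qed.

Lemma opnorm_ge0 T (X : op R T) : 0 <= opnorm X.
Proof.
rewrite /opnorm; set E := (X in sup X).
have E_ge0 t : E t -> 0 <= t by move=> [v [_ ->]]; exact: sqrtr_ge0.
(* Outside [has_sup] the value of [sup] is 0 by convention. *)
have [supE|/sup_out-> //] := pselect (has_sup E).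
case: (supE) => -[t Et] _; apply: le_trans (E_ge0 _ Et) _.
exact: (ub_le_sup (proj2 supE)).
Qed.

(** A crude bound is enough: [c] is the sum of the moduli of all entries, because |v_i| |v_j| <= <v,
    v> by the arithmetic-geometric mean inequality. *)
Lemma herm_bounded T (H : op R T) :
  (forall i j, Num.conj (H i j) = H j i) ->
  exists2 c : R, 0 <= c & psd (opsub (opscale (c%:C)%C (@delta R T)) H).
Proof.
move=> hermH; pose N : C := \sum_i \sum_j `|H i j|.
have N_ge0 : 0 <= N by do 2![apply: sumr_ge0 => ? _]; rewrite normr_ge0.
exists (complex.Re N); first by rewrite -lecR ge0_ReE.
rewrite ge0_ReE // => v.
pose q := \sum_i \sum_j Num.conj (v i) * H i j * v j.
pose n := \sum_i Num.conj (v i) * v i.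
have n_ge0 : 0 <= n by apply: sumr_ge0 => i _; rewrite mulrC mul_conjC_ge0.
rewrite qf_scaled_sub -/n -/q subr_ge0; apply: (@le_trans _ _ `|q|).
  (* Hermiticity makes the quadratic form real, so it is at most its modulus. *)
  apply: real_ler_norm; apply/CrealP; rewrite /q.
  rewrite rmorph_sum /= exchange_big /=; apply: eq_bigr => j _.
  rewrite rmorph_sum; apply: eq_bigr => i _ /=.
  by rewrite !rmorphM /= conjCK hermH; ring.
rewrite /N mulr_suml; apply: le_trans (ler_norm_sum _ _ _) _.
apply: ler_sum => i _; rewrite mulr_suml; apply: le_trans (ler_norm_sum _ _ _) _.
apply: ler_sum => j _; rewrite !normrM norm_conjC mulrAC [_ * `|H i j|]mulrC.
rewrite ler_wpM2l //.
have vn k : `|v k| ^+ 2 <= n.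
  rewrite /n (bigD1 k) //= normCK mulrC lerDl sumr_ge0 // => l _.
  by rewrite mulrC mul_conjC_ge0.
have : 0 <= (`|v i| - `|v j|) ^+ 2 by rewrite -realEsqr rpredB ?normr_real.
move=> h.
have h' : 2 * (`|v i| * `|v j|) <= 2 * n.
  apply: (@le_trans _ _ (`|v i| ^+ 2 + `|v j| ^+ 2)).
    by rewrite -subr_ge0; move: h; congr (0 <= _); ring.
  by rewrite mulr_natl mulr2n lerD.
by rewrite ler_pM2l in h'.
Qed.

End OperatorBounds.

(** * Hahn-Banach in finite dimension *)

Section HahnBanach.
Variables (R : realType) (I : finType).
Implicit Types (x y u : I -> R) (K : (I -> R) -> R -> Prop).

(* [K x s] stands for "s is an upper bound for the value at x": a convex cone
   in the graph space, whose fibrewise infimum is a sublinear functional. *)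
Record sublinear K : Prop := Sublinear {
  sublinear0 : K (fun=> 0) 0;
  sublinearD : forall x y s t, K x s -> K y t -> K (fun i => x i + y i) (s + t);
  sublinearZ : forall a x s, 0 < a -> K x s -> K (fun i => a * x i) (a * s);
  sublinear_dom : forall x, exists s, K x s;
  sublinear_proper : forall s, K (fun=> 0) s -> 0 <= s }.

Lemma sublinear_eq K x y s t : K x s -> x =1 y -> s = t -> K y t.
Proof. by move=> Kxs /funext <- <-. Qed.

(** The one-dimensional Hahn-Banach step. The value at [u] is pinned to the infimum [c] of the fibre
    over [u], the largest choice allowed, by adjoining the line through (u, c) to the cone. *)
Lemma sublinear_extend K u : sublinear K -> exists (c : R) K',
  [/\ sublinear K', forall x s, K x s -> K' x s, K' u c,
      K' (fun i => - u i) (- c) & forall d, (forall s, K u s -> d <= s) -> d <= c].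
Proof.
move=> [K0 KD KZ Kdom Kproper].
(* A bound [r] for -u bounds the fibre over [u] below by -r, so the infimum [c] is finite. *)
have [r Kr] := Kdom (fun i => - u i).
have Klb s : K u s -> - r <= s.
  move=> Ks; rewrite -subr_ge0 opprK; apply: Kproper.
  apply: sublinear_eq (KD _ _ _ _ Ks Kr) _ _ => // i; exact: subrr.
have Kne : ([set s | K u s] !=set0)%classic by case: (Kdom u) => s; exists s.
pose c := inf [set s | K u s]%classic.
have c_le s : K u s -> c <= s.
  by move=> Ks; apply: ge_inf => //; exists (- r) => t; exact: Klb.
have le_c b : (forall s, K u s -> b <= s) -> b <= c.
  by move=> lb; apply: lb_le_inf => // s; exact: lb.
pose K' x s := exists t, K (fun i => x i + t * u i) (s + t * c).
(* For t > 0, rescaling turns the membership into a bound s/t + c at [u], which is at least [c]. For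
   t < 0 it gives a bound at -u; adding it to any bound at [u] and using properness shows that c -
   s/(-t) is a lower bound of the fibre, hence at most [c]. *)
have proper' s : K' (fun=> 0) s -> 0 <= s.
  move=> [t Kt]; have [t0|t_gt0|t0] := ltgtP t 0; last first.
  - by move: Kt; rewrite t0 => /sublinear_eq Ks; apply: Kproper; apply: Ks => [i|]; ring.
  - have ti : 0 < t^-1 by rewrite invr_gt0.
    have /c_le : K u (t^-1 * s + c).
      by apply: sublinear_eq (KZ _ _ _ ti Kt) _ _ => [i|]; field; rewrite gt_eqF.
    by rewrite lerDr pmulr_rge0.
  - have ti : 0 < (- t)^-1 by rewrite invr_gt0 oppr_gt0.
    have /le_c : forall s', K u s' -> c - (- t)^-1 * s <= s'.
      move=> s' Ks'; rewrite lerBlDr -subr_ge0; apply: Kproper.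
      apply: sublinear_eq (KD _ _ _ _ Ks' (KZ _ _ _ ti Kt)) _ _ => [i|]; field; by rewrite lt_eqF.
    by rewrite gerBl pmulr_rge0.
have incl x s : K x s -> K' x s.
  by move=> Ks; exists 0; apply: sublinear_eq Ks _ _ => [i|]; ring.
exists c, K'; split => //.
- split => //.
  + exact: incl.
  + move=> x y s t [a Ka] [b Kb]; exists (a + b).
    by apply: sublinear_eq (KD _ _ _ _ Ka Kb) _ _ => [i|]; ring.
  + move=> a x s a_gt0 [b Kb]; exists (a * b).
    by apply: sublinear_eq (KZ _ _ _ a_gt0 Kb) _ _ => [i|]; ring.
  + by move=> x; case: (Kdom x) => s /incl; exists s.
- by exists (- 1); apply: sublinear_eq K0 _ _ => [i|]; ring.
- by exists 1; apply: sublinear_eq K0 _ _ => [i|]; ring.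
Qed.

Lemma sublinear_extend_seq (s : seq I) K : sublinear K -> exists (c : I -> R) K',
  [/\ sublinear K', forall x s, K x s -> K' x s &
      forall i, i \in s -> K' (fun j => (j == i)%:R) (c i) /\
                           K' (fun j => - (j == i)%:R) (- c i)].
Proof.
move=> slK; elim: s => [|k s [c [K1 [sl1 incl1 gen1]]]].
  by exists (fun=> 0), K.
have [b [K2 [sl2 incl2 gen2 gen2' _]]] := sublinear_extend (fun j => (j == k)%:R) sl1.
exists (fun i => if i == k then b else c i), K2; split => // [x t /incl1/incl2 //|i].
rewrite inE; have [->|ik] //= := eqVneq i k.
by move=> /gen1[/incl2 g /incl2 g'].
Qed.

(** The direction [x0] is pinned first, so that the functional attains the full infimum there;
    pinning the basis vectors afterwards puts the graph of a linear functional inside the cone. *)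
Lemma sublinear_dominates K (x0 : I -> R) : sublinear K -> exists f : I -> R,
  (forall x s, K x s -> \sum_i f i * x i <= s) /\
  (forall d, (forall s, K x0 s -> d <= s) -> d <= \sum_i f i * x0 i).
Proof.
move=> slK; case: (sublinear_extend x0 slK) => c [K1 [sl1 incl1 gen1 gen1' le_c]].
case: (sublinear_extend_seq (enum I) sl1) => f [K2 [sl2 incl2 gen2]].
have [K0 KD KZ _ Kproper] := sl2.
have gen t i : K2 (fun j => t * (j == i)%:R) (t * f i).
  have [g g'] := gen2 i (mem_enum _ i).
  have [t0|t_gt0|->] := ltgtP t 0.
  - have nt : 0 < - t by rewrite oppr_gt0.
    by apply: sublinear_eq (KZ _ _ _ nt g') _ _ => [j|]; rewrite mulrNN.
  - exact: KZ.
  - by apply: sublinear_eq K0 _ _ => [j|]; rewrite mul0r.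
have span x : K2 x (\sum_i f i * x i).
  have : K2 (fun j => \sum_(i <- enum I) x i * (j == i)%:R)
            (\sum_(i <- enum I) x i * f i).
    elim: (enum I) => [|i s IHs].
      by apply: sublinear_eq K0 _ _ => [j|]; rewrite big_nil.
    apply: sublinear_eq (KD _ _ _ _ (gen (x i) i) IHs) _ _ => [j|];
    by rewrite big_cons.
  move=> /sublinear_eq; apply => [j|]; rewrite big_enum /=.
    by under eq_bigr => i _ do rewrite eq_sym; rewrite sum_delta_r.
  by apply: eq_bigr => i _; rewrite mulrC.
(* The cone contains the graph point over -x; adding it to (x, s) gives a bound at 0, nonnegative by
   properness. *)
have neg x s : K2 x s -> \sum_i f i * x i <= s.
  move=> Ks; rewrite -subr_ge0 -sumrN; apply: Kproper.
  apply: sublinear_eq (KD _ _ _ _ Ks (span (fun i => - x i))) _ _ => [i|].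
    exact: subrr.
  by congr (_ + _); apply: eq_bigr => i _; rewrite mulrN.
exists f; split=> [x s /incl1/incl2/neg // |d /le_c/le_trans]; apply.
have /neg := incl2 _ _ gen1'.
under eq_bigr => i _ do rewrite mulrN.
by rewrite sumrN lerN2.
Qed.

End HahnBanach.

(** * Duality for the max-Rains program *)

Section PartialTransposeAndTrace.
Variable R : realType.
Local Notation C := R[i].
Implicit Types T U : finType.

Definition hermitian T (X : op R T) := forall i j, Num.conj (X i j) = X j i.

Lemma psd_hermitian T (X : op R T) : psd X -> hermitian X.
Proof. by move=> psdX i j; exact: psd_herm. Qed.

Definition extend_id T U (rho : op R T) : op R (T * U)%type :=
  fun p q => rho p.1 q.1 * (p.2 == q.2)%:R.
Arguments extend_id {T} U rho.

Lemma pairing_ptrace2 T U (rho : op R T) (V : op R (T * U)%type) :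
  pairing rho (ptrace2 V) = pairing (extend_id U rho) V.
Proof.
rewrite /pairing sum_pair; apply: eq_bigr => i _.
under [RHS]eq_bigr => k _ do rewrite sum_pair.
rewrite exchange_big; apply: eq_bigr => j _ /=.
rewrite /ptrace2 big_distrr; apply: eq_bigr => k _ /=.
rewrite -(@sum_delta_r _ _ k (fun l => rho i j * V (i, k) (j, l))).
by apply: eq_bigr => l _; rewrite /extend_id /= eq_sym; ring.
Qed.

Lemma trace_ptrace2 T U (V : op R (T * U)%type) : trace (ptrace2 V) = trace V.
Proof. by rewrite /trace sum_pair. Qed.

Lemma ptrace2D T U (V W : op R (T * U)%type) :
  ptrace2 (opadd V W) = opadd (ptrace2 V) (ptrace2 W).
Proof. by apply: op_ext => i j; rewrite /ptrace2 big_split. Qed.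

Lemma ptrace2Z T U a (V : op R (T * U)%type) :
  ptrace2 (opscale a V) = opscale a (ptrace2 V).
Proof. by apply: op_ext => i j; rewrite /opscale /ptrace2 big_distrr. Qed.

(** The quadratic form of the partial trace at [v] is the pairing of [V] with [rank1 v] (x) 1,
    itself a Schur product of two positive pullbacks. *)
Lemma psd_ptrace2 T U (V : op R (T * U)%type) : psd V -> psd (ptrace2 V).
Proof.
move=> psdV v; have psdv : psd (rank1 v) by exact: psd_rank1.
rewrite -pairing_rank1 pairingC pairing_ptrace2; apply: pairing_ge0 => //.
apply: psd_schur (psd_pullback (@fst T U) psdv) (psd_pullback (@snd T U) (@psd_delta R U)).
Qed.

Variables A B A' B' : finType.
Local Notation AB := (A * B)%type.
Local Notation A'B' := (A' * B')%type.
Local Notation bop := (op R (AB * A'B')%type).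

Lemma ptBB'K (X : bop) : ptBB' (ptBB' X) = X.
Proof. by apply: op_ext => -[[a b] [a' b']] [[c d] [c' d']]. Qed.

Lemma ptBB'_delta : ptBB' delta = delta :> bop.
Proof.
apply: op_ext => -[[a b] [a' b']] [[c d] [c' d']]; rewrite /ptBB' /delta /=.
by rewrite !xpair_eqE [d == b]eq_sym [d' == b']eq_sym.
Qed.

Lemma ptBB'_hermitian (X : bop) : hermitian X -> hermitian (ptBB' X).
Proof. by move=> hX p q; rewrite /ptBB' hX. Qed.

(** The partial transpose permutes pairs of indices by an involution, along which the double sum is
    reindexed. *)
Lemma pairing_ptBB' (X Y : bop) : pairing (ptBB' X) (ptBB' Y) = pairing X Y.
Proof.
pose s (z : (AB * A'B') * (AB * A'B')) := let: (p, q) := z in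
  (((p.1.1, q.1.2), (p.2.1, q.2.2)), ((q.1.1, p.1.2), (q.2.1, p.2.2))).
have sK : involutive s by move=> [[[a b] [a' b']] [[c d] [c' d']]].
rewrite /pairing !pair_bigA /= [RHS](reindex_inj (inv_inj sK)) /=.
by apply: eq_bigr => -[p q] _.
Qed.

Lemma pairing_ptBB'C (X Y : bop) : pairing X (ptBB' Y) = pairing (ptBB' X) Y.
Proof. by rewrite -pairing_ptBB' ptBB'K. Qed.

End PartialTransposeAndTrace.
Arguments extend_id {R T} U rho.

(** * Real coordinates for hermitian operators *)

Section RealCoordinates.
Variables (R : realType) (T : finType).
Local Notation C := R[i].
Implicit Types (x f : T * T * bool -> R) (G : op R T).

(** A redundant parametrization: symmetrizing makes every real vector a hermitian operator, so
    Hahn-Banach runs over a free coordinate space. [true] marks real parts, [false] imaginary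
    parts. *)
Definition hermitian_of x : op R T := fun i j =>
  Complex (x (i, j, true) + x (j, i, true)) (x (i, j, false) - x (j, i, false)).

Definition coords G : T * T * bool -> R := fun p =>
  (if p.2 then complex.Re (G p.1.1 p.1.2) else complex.Im (G p.1.1 p.1.2)) / 2.

(** The operator that represents [f] on coordinates through [pairing]. The factor 4 combines the 2
    of [coords] with that of symmetrization; the imaginary sign is opposite to [hermitian_of]
    because the pairing is bilinear, not sesquilinear. *)
Definition functional_op f : op R T := fun i j =>
  Complex ((f (i, j, true) + f (j, i, true)) / 4) ((f (j, i, false) - f (i, j, false)) / 4).

Lemma hermitian_of_herm x : hermitian (hermitian_of x).
Proof.
move=> i j; rewrite /hermitian_of.
by apply/eqP; rewrite eq_complex /= opprB addrC !eqxx.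
Qed.

Lemma hermitian_ofD x y :
  hermitian_of (fun i => x i + y i) = opadd (hermitian_of x) (hermitian_of y).
Proof.
apply: op_ext => i j; apply/eqP; rewrite eq_complex /opadd /hermitian_of /=.
by apply/andP; split; apply/eqP; ring.
Qed.

Lemma hermitian_ofZ (a : R) x :
  hermitian_of (fun i => a * x i) = opscale (a%:C)%C (hermitian_of x).
Proof.
apply: op_ext => i j; apply/eqP; rewrite eq_complex /opscale /hermitian_of /=.
by apply/andP; split; apply/eqP; ring.
Qed.

Lemma coordsK G : hermitian G -> hermitian_of (coords G) = G.
Proof.
move=> hG; apply: op_ext => i j; rewrite /hermitian_of /coords /= -(hG i j).
by case: (G i j) => a b /=; congr Complex; field.
Qed.

Lemma pairing_functional_op f G : hermitian G ->
  pairing (functional_op f) G = ((\sum_p f p * coords G p)%:C)%C.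
Proof.
move=> hG; pose a i j : C := Complex (f (i, j, true)) (- f (i, j, false)).
(* The entries are (a_ij + conj a_ji) / 4; after swapping indices in the second half, hermiticity of
   [G] makes the two halves conjugate term by term. *)
transitivity (4^-1 * (\sum_i \sum_j a i j * G i j)
              + 4^-1 * (\sum_i \sum_j Num.conj (a i j) * G j i)).
  rewrite [X in _ + _ * X]exchange_big !big_distrr -big_split.
  apply: eq_bigr => i _ /=; rewrite !big_distrr -big_split.
  apply: eq_bigr => j _ /=; rewrite !mulrA -mulrDl; congr (_ * _).
  rewrite /functional_op /a -mulrDr.
  rewrite (_ : 4^-1 = ((4^-1 : R)%:C)%C); last by rewrite fmorphV rmorph_nat.
  by apply/eqP; rewrite eq_complex /=; apply/andP; split; apply/eqP; ring.
rewrite !sum_pair rmorph_sum /= !big_distrr -big_split.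
apply: eq_bigr => i _ /=; rewrite rmorph_sum /= !big_distrr -big_split.
apply: eq_bigr => j _ /=; rewrite -(hG i j) big_bool -mulrDr /coords /a /=.
rewrite (_ : 4^-1 = ((4^-1 : R)%:C)%C); last by rewrite fmorphV rmorph_nat.
case: (G i j) => b c; apply/eqP; rewrite eq_complex /=.
by apply/andP; split; apply/eqP; field.
Qed.

End RealCoordinates.

(** * Strong duality through the perturbed primal program *)

Section StrongDuality.
Variables (R : realType) (A B A' B' : finType).
Local Notation C := R[i].
Local Notation AB := (A * B)%type.
Local Notation A'B' := (A' * B')%type.
Local Notation T := (AB * A'B')%type.

(** The max-Rains program with both constraints perturbed, by [G] and [S]. The feasible triples (G,
    S, s) form a convex cone, to which Hahn-Banach applies; the program itself is [G = choi N],
    [S = 0]. *)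
Definition rains_primal (G : op R T) (S : op R AB) (s : R) := exists V Y : op R T,
  [/\ psd V, psd Y, psd (opsub (ptBB' (opsub V Y)) G)
    & psd (opsub (opsub (opscale (s%:C)%C delta) (ptrace2 (opadd V Y))) S)].

Definition rains_dual (X : op R T) (rho : op R AB) :=
  dominated (ptBB' X) (extend_id A'B' rho) /\ trace rho = 1.

Lemma rains_primalD G G' S S' s s' : rains_primal G S s -> rains_primal G' S' s' ->
  rains_primal (opadd G G') (opadd S S') (s + s').
Proof.
move=> [V [Y [pV pY pG pS]]] [V' [Y' [pV' pY' pG' pS']]].
exists (opadd V V'), (opadd Y Y'); split; try exact: psd_add.
- move: (psd_add pG pG'); congr psd; apply: op_ext => p q.
  by rewrite /opadd /opsub /ptBB'; ring.
- move: (psd_add pS pS'); congr psd; apply: op_ext => p q.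
  by rewrite !ptrace2D /opadd /opsub /opscale rmorphD /=; ring.
Qed.

Lemma rains_primalZ (a : R) G S s : 0 < a -> rains_primal G S s ->
  rains_primal (opscale (a%:C)%C G) (opscale (a%:C)%C S) (a * s).
Proof.
move=> a_gt0 [V [Y [pV pY pG pS]]].
have a_ge0 : 0 <= (a%:C)%C :> C by rewrite lecR ltW.
exists (opscale (a%:C)%C V), (opscale (a%:C)%C Y); split; try exact: psd_scale.
- move: (psd_scale a_ge0 pG); congr psd; apply: op_ext => p q.
  by rewrite /opscale /opsub /ptBB'; ring.
- move: (psd_scale a_ge0 pS); congr psd; apply: op_ext => p q.
  by rewrite !ptrace2D !ptrace2Z /opadd /opsub /opscale rmorphM /=; ring.
Qed.

(** Take [Y = 0] and [V] a multiple of the identity that dominates [G]; the identity is fixed by the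
    partial transpose. Then [s] is chosen large. *)
Lemma rains_primal_exists G S : hermitian G -> hermitian S ->
  exists s, rains_primal G S s.
Proof.
move=> hG hS; have [c c_ge0 leG] := herm_bounded hG.
pose V : op R T := opscale (c%:C)%C delta.
have psdV : psd V by apply: psd_scale; [rewrite lecR | exact: psd_delta].
have [|s _ leS] := @herm_bounded _ _ (opadd (ptrace2 V) S).
  by move=> i j; rewrite /opadd rmorphD /= hS (psd_herm _ _ (psd_ptrace2 psdV)).
exists s, V, (fun _ _ => 0); split => //; first exact: psd0.
- move: leG; congr psd; apply: op_ext => p q.
  rewrite -[in LHS]ptBB'_delta /opsub /opscale /ptBB' /V /opscale /=; ring.
- move: leS; congr psd.
  have -> : opadd V (fun _ _ => 0) = V by apply: op_ext => p q; rewrite /opadd addr0.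
  by apply: op_ext => p q; rewrite /opadd /opsub; ring.
Qed.

(** Pair every constraint with the identity and add them, with tr Y >= 0 counted twice. This yields
    properness of the cone at [G = S = 0], and the bound 1 <= D. *)
Lemma rains_primal_trace G S s : rains_primal G S s ->
  trace G + trace S <= (s%:C)%C * #|{: AB}|%:R.
Proof.
move=> [V [Y [pV pY pG pS]]].
have pd K := @psd_delta R K.
have tr_delta : trace (@delta R AB) = #|{: AB}|%:R.
  rewrite /trace; under eq_bigr => i _ do rewrite /delta eqxx.
  by rewrite sumr_const.
have hY := pairing_ge0 (pd _) pY.
have hG := pairing_ge0 (pd _) pG.
rewrite (pairingBr _ (ptBB' _) G) pairing_ptBB'C ptBB'_delta pairingBr in hG.
have hS := pairing_ge0 (pd _) pS.
rewrite !pairingBr pairingZr in hS.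
rewrite !(pairingC delta) !pairing_delta trace_ptrace2 tr_delta in hY hG hS.
rewrite -[trace (opadd _ _)]pairing_delta pairingC pairingDr in hS.
rewrite !(pairingC delta) !pairing_delta in hS.
rewrite -subr_ge0.
have := addr_ge0 (addr_ge0 hS hG) (addr_ge0 hY hY).
by congr (0 <= _); ring.
Qed.

Hypothesis AB_gt0 : (0 < #|{: AB}|)%N.

Local Notation index := (T * T * bool + AB * AB * bool)%type.

Definition rains_cone (x : index -> R) (s : R) :=
  rains_primal (hermitian_of (fun p => x (inl p))) (hermitian_of (fun p => x (inr p))) s.

Lemma hermitian_of0 (K : finType) : hermitian_of (fun _ : K * K * bool => 0 : R) = fun _ _ => 0.
Proof. by apply: op_ext => i j; rewrite /hermitian_of addr0 subr0. Qed.

Lemma sublinear_rains_cone : sublinear rains_cone.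
Proof.
split.
- rewrite /rains_cone !hermitian_of0; exists (fun _ _ => 0), (fun _ _ => 0).
  split; try exact: psd0.
    by move: (@psd0 R T); congr psd; apply: op_ext => p q; rewrite /opsub /ptBB' !subr0.
  move: (@psd0 R AB); congr psd; apply: op_ext => p q.
  by rewrite /opsub /ptrace2 /opscale mul0r big1 ?subrr // => k _; rewrite /opadd addr0.
- by move=> x y s t xs yt; rewrite /rains_cone !hermitian_ofD; exact: rains_primalD.
- by move=> a x s a_gt0 xs; rewrite /rains_cone !hermitian_ofZ; exact: rains_primalZ.
- by move=> x; apply: rains_primal_exists; exact: hermitian_of_herm.
- move=> s /rains_primal_trace; rewrite !hermitian_of0 /trace !big1 // addr0.
  by rewrite pmulr_lge0 ?ltr0n // lecR.
Qed.

(* Hahn-Banach extension of the primal value, read back as a pair of operators. *)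
Lemma rains_functional J : hermitian J -> exists X rho (D : R),
  [/\ forall G S s, hermitian G -> hermitian S -> rains_primal G S s ->
        pairing X G + pairing rho S <= (s%:C)%C,
      pairing X J = (D%:C)%C &
      forall d, (forall s, rains_primal J (fun _ _ => 0) s -> d <= s) -> d <= D].
Proof.
move=> hJ; pose vec (G : op R T) (S : op R AB) (i : index) : R :=
  match i with inl p => coords G p | inr p => coords S p end.
have [f [f_le f_ge]] := sublinear_dominates (vec J (fun _ _ => 0)) sublinear_rains_cone.
pose X := functional_op (fun p => f (inl p)).
pose rho := functional_op (fun p => f (inr p)).
have hz : hermitian (fun _ _ : AB => 0 : C) by move=> i j; exact: conjC0.
have pairE G S : hermitian G -> hermitian S ->
    pairing X G + pairing rho S = ((\sum_i f i * vec G S i)%:C)%C.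
  move=> hG hS; rewrite /X /rho !pairing_functional_op // -rmorphD.
  by rewrite big_sumType.
exists X, rho, (\sum_i f i * vec J (fun _ _ => 0) i); split.
- move=> G S s hG hS primal; rewrite pairE // lecR; apply: f_le.
  by rewrite /rains_cone /= !coordsK.
- rewrite -pairE // [X in _ = _ + X]big1 ?addr0 // => i _.
  by rewrite big1 // => j _; rewrite mulr0.
- move=> d le_d; apply: f_ge => s; rewrite /rains_cone /= !coordsK //; exact: le_d.
Qed.

(** The dual constraints come from testing the Hahn-Banach functional on simple feasible triples,
    all with [V] and [Y] zero or rank one. *)
Lemma rains_strong_duality J : hermitian J -> trace J = #|{: AB}|%:R ->
  exists X rho (D : R), [/\ rains_dual X rho, pairing X J = (D%:C)%C, 1 <= D &
    forall d, (forall s, rains_primal J (fun _ _ => 0) s -> d <= s) -> d <= D].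
Proof.
move=> hJ trJ; have [X [rho [D [le_s XJ D_ge]]]] := rains_functional hJ.
have hz (K : finType) : hermitian (fun _ _ : K => 0 : C) by move=> i j; exact: conjC0.
have pair0 (K : finType) (Z : op R K) : pairing Z (fun _ _ => 0) = 0.
  by rewrite /pairing big1 // => i _; rewrite big1 // => j _; rewrite mulr0.
have psdz (K : finType) (Z : op R K) : (forall i j, Z i j = 0) -> psd Z.
  by move=> Z0; move: (@psd0 R K); congr psd; apply: op_ext => i j; rewrite Z0.
have psdv (K : finType) (v : K -> C) : psd (rank1 v) by exact: psd_rank1.
exists X, rho, D; split => //; last first.
  apply: D_ge => s /rains_primal_trace; rewrite trJ /trace big1 // addr0.
  by rewrite -[leLHS]mul1r ler_pM2r ?ltr0n // -(rmorph1 (real_complex R)) lecR.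
(* The triple (0, a 1, a) is feasible with [V = Y = 0]; the values a = 1 and a = -1 together give tr
   rho = 1. *)
have trrho (a : R) : (a%:C)%C * trace rho <= (a%:C)%C.
  have hd : hermitian (opscale (a%:C)%C (@delta R AB)).
    move=> i j; rewrite /opscale /delta rmorphM /= conjC_nat eq_sym.
    by rewrite conj_Creal // complex_real.
  have := le_s (fun _ _ => 0) _ a (hz _) hd.
  rewrite pair0 add0r pairingZr pairing_delta; apply.
  exists (fun _ _ => 0), (fun _ _ => 0); split; apply: psdz => // i j.
  - by rewrite /opsub /ptBB' !subr0.
  - by rewrite /opsub /opscale /ptrace2 big1 ?subr0 ?subrr // => k _; rewrite /opadd addr0.
split; last first.
  apply/eqP; rewrite eq_le; move: (trrho 1) (trrho (-1)).
  by rewrite rmorphN rmorph1 mul1r mulN1r lerN2 => -> ->.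
have hrank (K : finType) (v : K -> C) := psd_hermitian (psdv K v).
split=> v; rewrite -pairing_rank1 pairingC.
(* [V = 0] and [Y = rank1 v] meet both constraints with equality at [s = 0], which gives the lower
   bound -rho (x) 1 <= X^T_BB' at [v]. *)
- have hW := hrank _ v.
  have := @le_s (opscale (- 1) (ptBB' (rank1 v))) (opscale (- 1) (ptrace2 (rank1 v))) 0.
  rewrite !pairingZr pairing_ptBB'C pairing_ptrace2 !mulN1r -opprD oppr_le0.
  rewrite pairingDr ![pairing (rank1 v) _]pairingC addrC; apply.
  + by move=> p q; rewrite /opscale rmorphM rmorphN1 /= (ptBB'_hermitian hW).
  + move=> p q; rewrite /opscale rmorphM rmorphN1 /=.
    by rewrite (psd_herm _ _ (psd_ptrace2 (psdv _ v))).
  + exists (fun _ _ => 0), (rank1 v); split; rewrite ?psdv//; apply: psdz => // i j.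
      by rewrite /opsub /opscale /ptBB'; ring.
    by rewrite /opsub /opscale /ptrace2 mul0r /opadd; under eq_bigr do rewrite add0r; ring.
(* The mirror choice [V = rank1 v], [Y = 0] gives the upper bound. *)
- have hW := hrank _ v.
  have := @le_s (ptBB' (rank1 v)) (opscale (- 1) (ptrace2 (rank1 v))) 0.
  rewrite !pairingZr pairing_ptBB'C pairing_ptrace2 !mulN1r subr_le0.
  rewrite pairingBr ![pairing (rank1 v) _]pairingC subr_ge0; apply.
  + exact: ptBB'_hermitian.
  + move=> p q; rewrite /opscale rmorphM rmorphN1 /=.
    by rewrite (psd_herm _ _ (psd_ptrace2 (psdv _ v))).
  + exists (rank1 v), (fun _ _ => 0); split; rewrite ?psdv//; apply: psdz => // i j.
      by rewrite /opsub /ptBB'; ring.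
    by rewrite /opsub /opscale /ptrace2 mul0r /opadd; under eq_bigr do rewrite addr0; ring.
Qed.

End StrongDuality.

(** * Tensor powers *)

Section TensorPower.
Variable R : realType.
Local Notation C := R[i].
Implicit Types T E : finType.

(** The abstract index type [E] with its projections serves both operators on AB, through [slice2],
    and operators on ABA'B', through [slice4], with indices grouped by party. *)
Definition tensor_power T E n (proj : 'I_n -> E -> T) (X : op R T) : op R E :=
  fun p q => \prod_k X (proj k p) (proj k q).

(** Induction on the list of factors, starting from the all-ones operator, the unit of the Schur
    product. *)
Lemma dominated_tensor_power T E n (proj : 'I_n -> E -> T) (Q P : op R T) :
  dominated Q P -> dominated (tensor_power proj Q) (tensor_power proj P).
Proof.
move=> domQP; rewrite /tensor_power.
elim: (index_enum 'I_n) => [|k s IHs].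
  split; last by move: (@psd0 R E); congr psd; apply: op_ext => p q; rewrite /opsub !big_nil subrr.
  have := psd_add (@psd_all_ones R E) (@psd_all_ones R E).
  by congr psd; apply: op_ext => p q; rewrite /opadd !big_nil.
have := dominated_schur (dominated_pullback (proj k) domQP) IHs.
by congr dominated; apply: op_ext => p q; rewrite big_cons.
Qed.

Lemma psd_tensor_power T E n (proj : 'I_n -> E -> T) (X : op R T) :
  psd X -> psd (tensor_power proj X).
Proof.
move=> psdX; rewrite /tensor_power.
elim: (index_enum 'I_n) => [|k s IHs].
  by move: (@psd_all_ones R E); congr psd; apply: op_ext => p q; rewrite big_nil.
have := psd_schur (psd_pullback (proj k) psdX) IHs.
by congr psd; apply: op_ext => p q; rewrite big_cons.
Qed.

Definition slice2 (A B : finType) n (k : 'I_n) (p : n.-tuple A * n.-tuple B) : A * B :=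
  (tnth p.1 k, tnth p.2 k).

Definition slice4 (A B A' B' : finType) n (k : 'I_n)
    (p : (n.-tuple A * n.-tuple B) * (n.-tuple A' * n.-tuple B')) :
    (A * B) * (A' * B') :=
  (slice2 k p.1, slice2 k p.2).

(** Distributivity of product over sum, once a pair of tuples is identified with a function into
    pairs. *)
Lemma sum_prod_slice2 (A B : finType) n (F : 'I_n -> A * B -> C) :
  \sum_p \prod_k F k (slice2 k p) = \prod_k \sum_t F k t.
Proof.
rewrite bigA_distr_bigA /=.
rewrite (reindex (fun p : n.-tuple A * n.-tuple B => [ffun k => slice2 k p])) /=.
  by apply: eq_bigr => p _; apply: eq_bigr => k _; rewrite ffunE.
exists (fun f : {ffun 'I_n -> A * B} =>
          ([tuple (f k).1 | k < n], [tuple (f k).2 | k < n])) => [[s t] _|f _].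
  by congr pair; apply: eq_from_tnth => k; rewrite tnth_mktuple ffunE.
by apply/ffunP => k; rewrite ffunE /slice2 /= !tnth_mktuple; case: (f k).
Qed.

Lemma sum_prod_slice4 (A B A' B' : finType) n (F : 'I_n -> (A * B) * (A' * B') -> C) :
  \sum_p \prod_k F k (slice4 k p) = \prod_k \sum_t F k t.
Proof.
rewrite sum_pair.
transitivity (\sum_(i : n.-tuple A * n.-tuple B) \prod_k \sum_t F k (slice2 k i, t)).
  by apply: eq_bigr => i _; rewrite -sum_prod_slice2.
rewrite (sum_prod_slice2 (fun k s => \sum_t F k (s, t))).
by apply: eq_bigr => k _; rewrite [RHS]sum_pair.
Qed.

Variables A B A' B' : finType.
Local Notation AB := (A * B)%type.
Local Notation A'B' := (A' * B')%type.
Local Notation T := (AB * A'B')%type.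
Variable n : nat.

Lemma pairing_tensor_power (X Y : op R T) :
  pairing (tensor_power (@slice4 A B A' B' n) X) (tensor_power (@slice4 A B A' B' n) Y)
    = pairing X Y ^+ n.
Proof.
rewrite /pairing /tensor_power.
under eq_bigr => p _.
  under eq_bigr => q _ do rewrite -big_split /=.
  rewrite (sum_prod_slice4 (fun k t => X (slice4 k p) t * Y (slice4 k p) t)).
  over.
rewrite (sum_prod_slice4 (fun k s => \sum_t X s t * Y s t)).
by rewrite prodr_const card_ord.
Qed.

Lemma trace_tensor_power (X : op R AB) :
  trace (tensor_power (@slice2 A B n) X) = trace X ^+ n.
Proof.
by rewrite /trace (sum_prod_slice2 (fun _ t => X t t)) prodr_const card_ord.
Qed.

Lemma ptrace2_tensor_power (X : op R T) :
  ptrace2 (tensor_power (@slice4 A B A' B' n) X)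
    = tensor_power (@slice2 A B n) (ptrace2 X).
Proof.
apply: op_ext => i j; rewrite /ptrace2 /tensor_power.
exact: (sum_prod_slice2 (fun k t => X (slice2 k i, t) (slice2 k j, t))).
Qed.

Lemma ptBB'_tensor_power (X : op R T) :
  ptBB' (tensor_power (@slice4 A B A' B' n) X)
    = tensor_power (@slice4 A B A' B' n) (ptBB' X).
Proof. by []. Qed.

End TensorPower.

(** * Tensor powers of dual solutions, and PPT decompositions of Choi operators *)

Section TensorPowerDelta.
Variable R : realType.
Local Notation C := R[i].

Lemma tensor_power_delta (A B : finType) n :
  tensor_power (@slice2 A B n) (@delta R (A * B)%type) = delta.
Proof.
apply: op_ext => i j; rewrite /tensor_power /delta.
have [->|ij] := eqVneq i j; first by rewrite big1 // => k _; rewrite eqxx.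
suff [k ijk] : exists k, slice2 k i != slice2 k j.
  by rewrite (bigD1 k) //= (negPf ijk) mul0r.
apply/existsP; apply: contraR ij => /existsPn eq_ij.
have {}eq_ij k : slice2 k i = slice2 k j by apply/eqP; rewrite -[_ == _]negbK eq_ij.
case: i j eq_ij => [s t] [s' t'] eq_ij.
by apply/eqP; congr pair; apply: eq_from_tnth => k; case: (eq_ij k).
Qed.

Variables A B A' B' : finType.
Local Notation AB := (A * B)%type.
Local Notation A'B' := (A' * B')%type.
Local Notation T := (AB * A'B')%type.

Lemma extend_id_tensor_power n (rho : op R AB) :
  extend_id _ (tensor_power (@slice2 A B n) rho)
    = tensor_power (@slice4 A B A' B' n) (extend_id A'B' rho).
Proof.
apply: op_ext => p q; rewrite /extend_id /tensor_power /= big_split /=.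
by rewrite -[X in _ = _ * X](_ : tensor_power (@slice2 A' B' n) delta p.2 q.2 = _) // tensor_power_delta.
Qed.

Lemma rains_dual_tensor_power n (X : op R T) (rho : op R AB) : rains_dual X rho ->
  rains_dual (tensor_power (@slice4 A B A' B' n) X) (tensor_power (@slice2 A B n) rho).
Proof.
move=> [dom tr1]; split; last by rewrite trace_tensor_power tr1 expr1n.
by rewrite ptBB'_tensor_power extend_id_tensor_power; exact: dominated_tensor_power.
Qed.

Definition ppt_choi (J : op R T) := [/\ psd J, psd (ptBB' J) & ptrace2 J = delta].

(** Transposing both arguments bounds the pairing by that of rho (x) 1 with J^T_BB', which is tr rho
    = 1. *)
Lemma rains_dual_ppt_choi (X : op R T) rho J : rains_dual X rho -> ppt_choi J ->
  pairing X J <= 1 /\ - pairing X J <= 1.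
Proof.
move=> [dom tr1] [_ psdJ trJ].
have := dominated_pairing dom psdJ; rewrite pairing_ptBB'.
(* Tracing out A'B' absorbs the transpose on B'; the one left on B fixes the identity. *)
rewrite -pairing_ptrace2 (_ : ptrace2 (ptBB' J) = delta) ?pairing_delta ?tr1 //.
apply: op_ext => -[a b] [a' b'].
have /(congr1 (fun Z => Z (a, b') (a', b))) : ptrace2 J = delta by [].
by rewrite /ptrace2 /delta !xpair_eqE /= [b' == b]eq_sym => <-; apply: eq_bigr => -[].
Qed.

Definition ppt_decomposition (J : op R T) (t : R) := exists (c1 c2 : R) (J1 J2 : op R T),
  [/\ 0 <= c1 /\ 0 <= c2, ppt_choi J1, ppt_choi J2,
      J = opsub (opscale (c1%:C)%C J1) (opscale (c2%:C)%C J2) & t = c1 + c2].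

Lemma rains_weak_duality (X : op R T) rho J t : rains_dual X rho ->
  ppt_decomposition J t -> pairing X J <= (t%:C)%C.
Proof.
move=> dual [c1 [c2 [J1 [J2 [[c1_ge0 c2_ge0] ppt1 ppt2 -> ->]]]]].
rewrite pairingBr !pairingZr rmorphD -mulrN /=.
have [le1 _] := rains_dual_ppt_choi dual ppt1.
have [_ le2] := rains_dual_ppt_choi dual ppt2.
by rewrite lerD // -[leRHS]mulr1 ler_wpM2l // lecR.
Qed.

Lemma ppt_choi_mix (a b : R) (J L : op R T) : 0 <= a -> 0 <= b ->
  ppt_choi J -> ppt_choi L ->
  exists2 K, ppt_choi K &
    opadd (opscale (a%:C)%C J) (opscale (b%:C)%C L) = opscale ((a + b)%:C)%C K.
Proof.
move=> a_ge0 b_ge0 pptJ pptL.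
have [ab0|ab0] := eqVneq (a + b) 0.
  exists J => //; have /andP[/eqP -> /eqP ->] : (a == 0) && (b == 0).
    by rewrite -paddr_eq0 // ab0.
  by apply: op_ext => p q; rewrite /opadd /opscale addr0 !mul0r addr0.
have abC0 : ((a + b)%:C)%C != 0 :> C by rewrite fmorph_eq0.
have ca : 0 <= (a%:C)%C / ((a + b)%:C)%C :> C.
  by rewrite mulr_ge0 ?invr_ge0 ?lecR // addr_ge0.
have cb : 0 <= (b%:C)%C / ((a + b)%:C)%C :> C.
  by rewrite mulr_ge0 ?invr_ge0 ?lecR // addr_ge0.
move: pptJ pptL => [psdJ psdJt trJ] [psdL psdLt trL].
exists (opadd (opscale ((a%:C)%C / ((a + b)%:C)%C) J)
              (opscale ((b%:C)%C / ((a + b)%:C)%C) L)).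
  split; first by apply: psd_add; exact: psd_scale.
    exact: psd_add (psd_scale ca psdJt) (psd_scale cb psdLt).
  rewrite ptrace2D !ptrace2Z trJ trL; apply: op_ext => p q.
  by rewrite /opadd /opscale -mulrDl -mulrDl -rmorphD mulfV // mul1r.
apply: op_ext => p q; rewrite /opadd /opscale.
by move: abC0; generalize ((a + b)%:C)%C => s s0; field.
Qed.

(** With [c] large enough that J^T_BB' + c 1 >= 0, mixing in the completely depolarizing channel,
    whose Choi operator is 1/d, makes [J] PPT: J = (1 + cd) J1 - cd D with J1 = (J + c 1) / (1 +
    cd). The infimum defining gamma is thus over a nonempty set. *)
Lemma ppt_decomposition_exists (J : op R T) : (0 < #|{: A'B'}|)%N ->
  psd J -> ptrace2 J = delta -> exists t, ppt_decomposition J t.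
Proof.
move=> A'B'_gt0 psdJ trJ.
have hH : hermitian (opscale (-1) (ptBB' J)).
  move=> p q; rewrite /opscale rmorphM rmorphN1 /=.
  by rewrite (ptBB'_hermitian (psd_hermitian psdJ)).
have [c c_ge0 psdc] := herm_bounded hH.
pose d : R := #|{: A'B'}|%:R; pose D : op R T := opscale ((d^-1)%:C)%C delta.
have d_gt0 : 0 < d by rewrite ltr0n.
have pptD : ppt_choi D.
  have di : 0 <= ((d^-1)%:C)%C :> C by rewrite lecR invr_ge0 ltW.
  split; first exact: psd_scale (@psd_delta _ _).
    have := psd_scale di (@psd_delta R T); congr psd.
    by apply: op_ext => p q; rewrite -[in LHS]ptBB'_delta.
  rewrite ptrace2Z; apply: op_ext => i j; rewrite /opscale /ptrace2 /delta.
  under eq_bigr => k _ do rewrite xpair_eqE eqxx andbT.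
  rewrite sumr_const -[_ *+ #|_|]mulr_natr -(rmorph_nat (real_complex R) #|_|).
  by rewrite mulrCA -rmorphM mulVf ?rmorph1 ?mulr1 // gt_eqF.
have cd_ge0 : 0 <= c * d by rewrite mulr_ge0 // ltW.
have s_neq0 : ((1 + c * d)%:C)%C != 0 :> C.
  by rewrite fmorph_eq0 gt_eqF // ltr_wpDr.
have s_ge0 : 0 <= ((1 + c * d)%:C)%C^-1 :> C by rewrite invr_ge0 lecR addr_ge0.
have cC : 0 <= (c%:C)%C :> C by rewrite lecR.
have cdE : ((c * d)%:C)%C * ((d^-1)%:C)%C = (c%:C)%C :> C.
  by rewrite -rmorphM mulfK // gt_eqF.
exists (1 + c * d + c * d), (1 + c * d), (c * d).
exists (opscale ((1 + c * d)%:C)%C^-1 (opadd J (opscale (c%:C)%C delta))), D.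
split => //; first by rewrite addr_ge0.
- split.
  + exact: psd_scale (psd_add psdJ (psd_scale cC (@psd_delta _ _))).
  + have := psd_scale s_ge0 psdc; congr psd; rewrite -[in LHS]ptBB'_delta.
    by apply: op_ext => p q; rewrite /opsub /opscale /ptBB' /opadd; ring.
  + rewrite ptrace2Z ptrace2D trJ -cdE.
    have -> : opscale (((c * d)%:C)%C * ((d^-1)%:C)%C) delta = opscale (((c * d)%:C)%C) D.
      by apply: op_ext => p q; rewrite /opscale mulrA.
    case: pptD => _ _ trD; rewrite ptrace2Z trD.
    apply: op_ext => p q; rewrite /opscale /opadd -[X in _ * (X + _)]mul1r -mulrDl.
    by rewrite -(rmorph1 (real_complex R)) -rmorphD mulrA mulVf // mul1r.
- apply: op_ext => p q; rewrite /opsub /opscale /opadd /D /opscale.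
  by rewrite mulrA mulfV // mul1r mulrA cdE addrK.
Qed.

End TensorPowerDelta.

(** * Tensor products of PPT decompositions *)

Section TensorProduct.
Variable R : realType.
Local Notation C := R[i].

Definition first2 (A B : finType) m n (p : (m + n).-tuple A * (m + n).-tuple B) :
    m.-tuple A * m.-tuple B :=
  ([tuple tnth p.1 (lshift n k) | k < m], [tuple tnth p.2 (lshift n k) | k < m]).

Definition last2 (A B : finType) m n (p : (m + n).-tuple A * (m + n).-tuple B) :
    n.-tuple A * n.-tuple B :=
  ([tuple tnth p.1 (rshift m k) | k < n], [tuple tnth p.2 (rshift m k) | k < n]).

Definition cat2 (A B : finType) m n (p : m.-tuple A * m.-tuple B)
    (q : n.-tuple A * n.-tuple B) : (m + n).-tuple A * (m + n).-tuple B :=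
  ([tuple of p.1 ++ q.1], [tuple of p.2 ++ q.2]).

Lemma first2_cat2 (A B : finType) m n (p : m.-tuple A * m.-tuple B)
  (q : n.-tuple A * n.-tuple B) : first2 (cat2 p q) = p.
Proof.
case: p => a b; congr pair; apply: eq_from_tnth => k;
by rewrite tnth_mktuple tnth_lshift.
Qed.

Lemma last2_cat2 (A B : finType) m n (p : m.-tuple A * m.-tuple B)
  (q : n.-tuple A * n.-tuple B) : last2 (cat2 p q) = q.
Proof.
case: q => a b; congr pair; apply: eq_from_tnth => k;
by rewrite tnth_mktuple tnth_rshift.
Qed.

Lemma cat2_first2_last2 (A B : finType) m n (p : (m + n).-tuple A * (m + n).-tuple B) :
  cat2 (first2 p) (last2 p) = p.
Proof.
case: p => a b; congr pair; apply: eq_from_tnth => k;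
by case: (splitP k) => l kl;
   [have -> : k = lshift n l by exact: val_inj
   |have -> : k = rshift m l by exact: val_inj];
   rewrite ?tnth_lshift ?tnth_rshift tnth_mktuple.
Qed.

Lemma sum_cat2 (A B : finType) m n (F : m.-tuple A * m.-tuple B -> n.-tuple A * n.-tuple B -> C) :
  \sum_p F (first2 p) (last2 p) = \sum_p \sum_q F p q.
Proof.
rewrite pair_bigA [RHS](reindex (fun p : (m + n).-tuple A * (m + n).-tuple B =>
  (first2 p, last2 p))) //=.
exists (fun z => cat2 z.1 z.2) => [p _|[p q] _] /=; first exact: cat2_first2_last2.
by rewrite first2_cat2 last2_cat2.
Qed.

Variables A B A' B' : finType.
Local Notation T n := ((n.-tuple A * n.-tuple B) * (n.-tuple A' * n.-tuple B'))%type.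
Variables m n : nat.

Definition first4 (p : T (m + n)) : T m := (first2 p.1, first2 p.2).
Definition last4 (p : T (m + n)) : T n := (last2 p.1, last2 p.2).

Definition tensor (J : op R (T m)) (L : op R (T n)) : op R (T (m + n)) :=
  schur (pullback first4 J) (pullback last4 L).

Lemma ptBB'_tensor J L : ptBB' (tensor J L) = tensor (ptBB' J) (ptBB' L).
Proof. by []. Qed.

Lemma psd_tensor J L : psd J -> psd L -> psd (tensor J L).
Proof. by move=> pJ pL; apply: psd_schur; exact: psd_pullback. Qed.

Lemma ppt_choi_tensor J L : ppt_choi J -> ppt_choi L -> ppt_choi (tensor J L).
Proof.
move=> [pJ ptJ trJ] [pL ptL trL]; split; rewrite ?ptBB'_tensor; try exact: psd_tensor.
apply: op_ext => i j; rewrite /ptrace2 /tensor /schur /pullback.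
rewrite (sum_cat2 (fun p q => J (first2 i, p) (first2 j, p) * L (last2 i, q) (last2 j, q))).
transitivity (ptrace2 J (first2 i) (first2 j) * ptrace2 L (last2 i) (last2 j)).
  by rewrite big_distrl; apply: eq_bigr => p _; rewrite big_distrr.
rewrite trJ trL /delta -natrM mulnb; congr (nat_of_bool _)%:R.
apply/andP/eqP => [[/eqP eq1 /eqP eq2]|-> //].
by rewrite -(cat2_first2_last2 i) eq1 eq2 cat2_first2_last2.
Qed.

Lemma tensor_power_add (J : op R ((A * B) * (A' * B'))%type) :
  tensor_power (@slice4 A B A' B' (m + n)) J
  = tensor (tensor_power (@slice4 A B A' B' m) J) (tensor_power (@slice4 A B A' B' n) J).
Proof.
apply: op_ext => p q; rewrite /tensor_power big_split_ord /=.
by congr (_ * _); apply: eq_bigr => k _;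
   rewrite /slice4 /slice2 /= !tnth_mktuple.
Qed.

(** Expand the product and group terms by sign. Each group is a nonnegative multiple of one PPT Choi
    operator by convexity, and the four coefficients sum to (c1 + c2) (d1 + d2). *)
Lemma ppt_decomposition_tensor J L s t :
  ppt_decomposition J s -> ppt_decomposition L t ->
  ppt_decomposition (tensor J L) (s * t).
Proof.
move=> [c1 [c2 [J1 [J2 [[c1_ge0 c2_ge0] pJ1 pJ2 -> ->]]]]].
move=> [d1 [d2 [L1 [L2 [[d1_ge0 d2_ge0] pL1 pL2 -> ->]]]]].
have [K1 pK1 defK1] := ppt_choi_mix (mulr_ge0 c1_ge0 d1_ge0) (mulr_ge0 c2_ge0 d2_ge0)
  (ppt_choi_tensor pJ1 pL1) (ppt_choi_tensor pJ2 pL2).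
have [K2 pK2 defK2] := ppt_choi_mix (mulr_ge0 c1_ge0 d2_ge0) (mulr_ge0 c2_ge0 d1_ge0)
  (ppt_choi_tensor pJ1 pL2) (ppt_choi_tensor pJ2 pL1).
exists (c1 * d1 + c2 * d2), (c1 * d2 + c2 * d1), K1, K2; split => //; last by ring.
  by rewrite !addr_ge0 ?mulr_ge0.
rewrite -defK1 -defK2; apply: op_ext => p q.
by rewrite /tensor /schur /pullback /opsub /opadd /opscale !rmorphM /=; ring.
Qed.

End TensorProduct.

(** * The correspondence between channels and Choi operators *)

Section ChoiRepresentation.
Variable R : realType.
Local Notation C := R[i].

Definition of_choi (T U : finType) (J : op R (T * U)%type) : lmap R T U :=
  fun X p q => \sum_i \sum_j X i j * J (i, p) (j, q).

Lemma choi_of_choi (T U : finType) (J : op R (T * U)%type) : choi (of_choi J) = J.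
Proof.
apply: op_ext => -[i p] [j q]; rewrite /choi /of_choi /Eij /=.
under eq_bigr => k _.
  under eq_bigr => l _ do rewrite -mulnb natrM -mulrA mulrCA.
  rewrite sum_delta; over.
by rewrite sum_delta.
Qed.

Lemma of_choi_channel (T U : finType) (J : op R (T * U)%type) :
  psd J -> ptrace2 J = delta -> channel (of_choi J).
Proof.
move=> psdJ trJ; split.
- move=> a X Y p q; rewrite /of_choi big_distrr -big_split; apply: eq_bigr => i _ /=.
  by rewrite big_distrr -big_split; apply: eq_bigr => j _ /=; ring.
- move=> K X psdX.
  (* The output of id (x) f contracts the input index of a Schur product of pullbacks of [X] and
     [J]. *)
  have := psd_schur (psd_pullback (fun p : (K * U) * T => (p.1.1, p.2)) psdX)
                    (psd_pullback (fun p : (K * U) * T => (p.2, p.1.2)) psdJ).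
  move/psd_partial_sum; congr psd; apply: op_ext => p q.
  apply: eq_bigr => i _; apply: eq_bigr => j _.
  have := congr1 (fun Z => Z (i, p.2) (j, q.2)) (choi_of_choi J).
  by rewrite /choi /schur /pullback /= => ->.
- move=> X; rewrite /trace /of_choi exchange_big; apply: eq_bigr => i _ /=.
  rewrite exchange_big /=.
  rewrite -[RHS](@sum_delta_r _ _ i (X i)); apply: eq_bigr => j _.
  rewrite -big_distrr /=; congr (_ * _).
  by have /(congr1 (fun Z => Z i j)) := trJ; rewrite /delta eq_sym.
Qed.

Lemma psd_choi (T U : finType) (f : lmap R T U) :
  completely_positive f -> psd (choi f).
Proof.
(* The Choi operator is the image of the unnormalized maximally entangled state. *)
move=> cpf; have := cpf T _ (psd_rank1 (fun p : T * T => (p.1 == p.2)%:R)).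
congr psd; apply: op_ext => p q; rewrite /tensor_id /rank1 /choi /=.
under eq_bigr => i _.
  under eq_bigr => j _ do rewrite conjC_nat -mulrA mulrCA [q.1 == j]eq_sym.
  rewrite sum_delta [p.1 == i]eq_sym; over.
by rewrite sum_delta.
Qed.

Lemma ptrace2_choi (T U : finType) (f : lmap R T U) :
  trace_preserving f -> ptrace2 (choi f) = delta.
Proof.
move=> tpf; apply: op_ext => i j; rewrite /ptrace2 /choi /=.
have := tpf (Eij _ i j); rewrite /trace => ->.
under eq_bigr => k _ do rewrite /Eij -mulnb natrM.
by rewrite sum_delta.
Qed.

Variables A B A' B' : finType.

Lemma ppt_choi_of_channel (f : lmap R (A * B)%type (A' * B')%type) :
  ppt_channel f -> ppt_choi (choi f).
Proof. by move=> [[_ cp tp] ptf]; split; [exact: psd_choi| |exact: ptrace2_choi]. Qed.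

Lemma ppt_channel_of_choi (J : op R ((A * B) * (A' * B'))%type) :
  ppt_choi J -> ppt_channel (of_choi J).
Proof. by move=> [pJ ptJ trJ]; split; [exact: of_choi_channel|rewrite choi_of_choi]. Qed.

Lemma gamma_PPT_of_choi (J : op R ((A * B) * (A' * B'))%type) :
  gamma_PPT (of_choi J) = inf [set t | ppt_decomposition J t]%classic.
Proof.
rewrite /gamma_PPT; congr inf; apply/seteqP; split => t /=.
  move=> [c1 [c2 [M1 [M2 [c_ge0 /ppt_choi_of_channel p1 /ppt_choi_of_channel p2 eqN ->]]]]].
  exists c1, c2, (choi M1), (choi M2); split => //.
  by rewrite -[LHS]choi_of_choi; apply: op_ext => p q; rewrite /choi eqN.
move=> [c1 [c2 [J1 [J2 [c_ge0 p1 p2 -> ->]]]]].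
exists c1, c2, (of_choi J1), (of_choi J2); split => //.
- exact: ppt_channel_of_choi.
- exact: ppt_channel_of_choi.
- move=> X p q; rewrite /of_choi !big_distrr -sumrB; apply: eq_bigr => i _ /=.
  rewrite !big_distrr -sumrB; apply: eq_bigr => j _ /=.
  by rewrite /opsub /opscale; ring.
Qed.

(** [tpow] is given by its values on matrix units, so this holds by computation and
    [gamma_PPT_of_choi] applies to it. *)
Lemma tpow_of_choi n (N : lmap R (A * B)%type (A' * B')%type) :
  @tpow R A B A' B' n N = of_choi (tensor_power (@slice4 A B A' B' n) (choi N)).
Proof. by []. Qed.

End ChoiRepresentation.

(** * Fekete's lemma and the limit *)

Section Fekete.
Variable R : realType.
Local Open Scope classical_set_scope.

Lemma subadditive_muln (a : nat -> R) (M : nat) : (forall m n, a (m + n)%N <= a m + a n) ->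
  forall q r, a (q * M + r)%N <= q%:R * a M + a r.
Proof.
move=> a_sub; elim=> [|q IHq] r; first by rewrite mul0n mul0r !add0r.
rewrite mulSn -addnA; apply: le_trans (a_sub _ _) _.
by rewrite -natr1 mulrDl mul1r addrAC [leRHS]addrC lerD2l.
Qed.

(** The limit is the infimum of the ratios. Fix M whose ratio is within e/2 of it and write n + 1 =
    q M + r: the q blocks contribute at most the ratio at M, and the remainder is negligible for
    large n. *)
Lemma fekete (a : nat -> R) : (forall n, 0 <= a n) ->
  (forall m n, a (m + n)%N <= a m + a n) ->
  cvgn (fun n => a n.+1 / n.+1%:R).
Proof.
move=> a_ge0 a_sub; pose E := [set a n.+1 / n.+1%:R | n in [set: nat]].
have Elb : lbound E 0 by move=> _ [n _ <-]; rewrite divr_ge0.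
have infE : has_inf E by split; [exists (a 1%N / 1%:R), 0%N | exists 0].
apply: (@cvgP _ _ (inf E)); apply/cvgrPdist_lt => e e_gt0.
have e2_gt0 : 0 < e / 2 by rewrite divr_gt0.
have [_ [k _ <-] ltk] := inf_adherent e2_gt0 infE.
(* By nonnegativity the sum [c] bounds every remainder term a_r with r < M. *)
pose M := k.+1; pose c := \sum_(r < M) a r.
have c_ge r : (r < M)%N -> a r <= c.
  move=> rM; rewrite /c (bigD1 (Ordinal rM)) //= lerDl; exact: sumr_ge0.
near=> n.
have n_gt : c / (e / 2) < n.+1%:R.
  apply: (@lt_trans _ _ n%:R); last by rewrite ltr_nat.
  by near: n; exact: nbhs_infty_gtr.
have n_gt0 : 0 < n.+1%:R :> R by rewrite ltr0n.
have M_gt0 : 0 < M%:R :> R by rewrite ltr0n.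
have inf_le : inf E <= a n.+1 / n.+1%:R by apply: ge_inf; [exists 0 | exists n].
rewrite distrC ger0_norm ?subr_ge0 // ltrBlDr addrC.
apply: (@le_lt_trans _ _ (a M / M%:R + c / n.+1%:R)); last first.
  rewrite [e]splitr addrA ltrD // ltr_pdivrMr // mulrC -ltr_pdivrMr //.
rewrite ler_pdivrMr // mulrDl divfK ?gt_eqF //.
rewrite [in leLHS](divn_eq n.+1 M); apply: le_trans (@subadditive_muln a M a_sub _ _) _.
apply: lerD; last by apply: c_ge; rewrite ltn_mod.
rewrite mulrC -mulrA ler_wpM2l // mulrC ler_pdivlMr // -natrM ler_nat.
exact: leq_divM.
Unshelve. all: by end_near. Qed.

(** Fekete's lemma for ln g, nonnegative because g >= 1, followed by continuity of the
    exponential. *)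
Lemma submultiplicative_root_cvg (g : nat -> R) : (forall n, 1 <= g n) ->
  (forall m n, g (m + n)%N <= g m * g n) ->
  cvgn (fun n => g n.+1 `^ (n.+1%:R)^-1).
Proof.
move=> g_ge1 g_sub; have g_gt0 n : 0 < g n by apply: lt_le_trans (g_ge1 n).
have /(_ _ _)/cvg_ex[|m n|l ln_cvg] := @fekete (fun n => ln (g n)).
- by move=> n; rewrite ln_ge0.
- by rewrite -lnM ?posrE // ler_ln ?posrE ?mulr_gt0.
apply: (@cvgP _ _ (expR l)).
rewrite (_ : (fun n => _) = expR \o (fun n => ln (g n.+1) / n.+1%:R)).
  by apply: continuous_cvg => //; exact: continuous_expR.
by apply: funext => n /=; rewrite /powR gt_eqF // mulrC.
Qed.

End Fekete.

(** * The bound for every tensor power *)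

Section RainsBound.
Variables (R : realType) (A B A' B' : finType).
Variable N : lmap R (A * B)%type (A' * B')%type.
Hypotheses (A_gt0 : (0 < #|A|)%N) (B_gt0 : (0 < #|B|)%N).
Hypotheses (A'_gt0 : (0 < #|A'|)%N) (B'_gt0 : (0 < #|B'|)%N).
Hypothesis channelN : channel N.
Local Notation C := R[i].
Local Notation gamma n := (gamma_PPT (@tpow R A B A' B' n N)).
Local Notation power n := (tensor_power (@slice4 A B A' B' n) (choi N)).

Let psdJ : psd (choi N). Proof. by case: channelN => _ /psd_choi. Qed.
Let trJ : ptrace2 (choi N) = delta. Proof. by case: channelN => _ _ /ptrace2_choi. Qed.

(** Feasibility at level [s] means 0 <= tr_A'B'(V + Y) <= s 1, so the operator norm in [Gamma22] is
    at most [s]. *)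
Lemma Gamma22_lower_bound s : rains_primal (choi N) (fun _ _ => 0) s -> Gamma22 N <= s.
Proof.
move=> [V [Y [pV pY pG pS]]]; apply: (@le_trans _ _ (opnorm (ptrace2 (opadd V Y)))).
  apply: ge_inf; last by exists V, Y.
  by exists 0 => _ [V' [Y' [_ _ _ ->]]]; exact: opnorm_ge0.
apply: opnorm_le; first by rewrite card_prod muln_gt0 A_gt0.
  exact: psd_ptrace2 (psd_add pV pY).
by move: pS; congr psd; apply: op_ext => i j; rewrite /opsub subr0.
Qed.

Lemma ppt_decomposition_power n : exists t, ppt_decomposition (power n) t.
Proof.
apply: ppt_decomposition_exists.
- by rewrite card_prod !card_tuple muln_gt0 !expn_gt0 A'_gt0 B'_gt0.
- exact: psd_tensor_power.
- by rewrite ptrace2_tensor_power trJ tensor_power_delta.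
Qed.

Lemma gamma_powerE n : gamma n = inf [set t | ppt_decomposition (power n) t]%classic.
Proof. by rewrite tpow_of_choi gamma_PPT_of_choi. Qed.

Lemma gamma_lower_bound n d :
  (forall t, ppt_decomposition (power n) t -> d <= t) -> d <= gamma n.
Proof. by move=> le_d; rewrite gamma_powerE; apply: lb_le_inf (ppt_decomposition_power n) _. Qed.

Lemma gamma_le n t : ppt_decomposition (power n) t -> gamma n <= t.
Proof.
move=> dec; rewrite gamma_powerE; apply: ge_inf => //.
by exists 0 => _ [c1 [c2 [_ [_ [[c1_ge0 c2_ge0] _ _ _ ->]]]]]; exact: addr_ge0.
Qed.

(** The two infima are taken one at a time, dividing by the other factor; this is where positivity
    enters. *)
Lemma gamma_submultiplicative m n : 0 < gamma m -> 0 < gamma n ->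
  gamma (m + n) <= gamma m * gamma n.
Proof.
move=> gm gn; rewrite -ler_pdivrMr //; apply: gamma_lower_bound => s dec_s.
rewrite ler_pdivrMr // mulrC.
have [s_le0|s_gt0] := leP s 0.
  by have := le_lt_trans s_le0 gm; rewrite ltNge gamma_le.
rewrite -ler_pdivrMr //; apply: gamma_lower_bound => t dec_t.
rewrite ler_pdivrMr // mulrC; apply: gamma_le; rewrite tensor_power_add.
exact: ppt_decomposition_tensor.
Qed.

Lemma rains_bound : exists D : R, [/\ 1 <= D, Gamma22 N <= D &
  forall n, D ^+ n <= gamma n].
Proof.
have AB_gt0 : (0 < #|{: A * B}|)%N by rewrite card_prod muln_gt0 A_gt0.
have trE : trace (choi N) = #|{: A * B}|%:R.
  rewrite -trace_ptrace2 trJ /trace; under eq_bigr => i _ do rewrite /delta eqxx.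
  by rewrite sumr_const.
have [X [rho [D [dual XJ D_ge1 D_ge]]]] := rains_strong_duality AB_gt0 (psd_hermitian psdJ) trE.
exists D; split => //; first exact: D_ge Gamma22_lower_bound.
move=> n; apply: gamma_lower_bound => t dec.
have := rains_weak_duality (rains_dual_tensor_power n dual) dec.
by rewrite pairing_tensor_power XJ -rmorphXn lecR.
Qed.

End RainsBound.

Unset Implicit Arguments.
Set Strict Implicit.

Theorem theoremS3 (R : realType) (A B A' B' : finType)
    (N : lmap R (A * B)%type (A' * B')%type) :
  (0 < #|A|)%N -> (0 < #|B|)%N -> (0 < #|A'|)%N -> (0 < #|B'|)%N ->
  channel N ->
  (2 : R) `^ (Rmax22 N) <= gamma_PPT_inf N.
Proof.
move=> A_gt0 B_gt0 A'_gt0 B'_gt0 chN.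
have [D [D_ge1 Gamma_le D_le]] := rains_bound A_gt0 B_gt0 A'_gt0 B'_gt0 chN.
pose g n := gamma_PPT (@tpow R A B A' B' n N).
have D_gt0 : 0 < D by apply: lt_le_trans D_ge1.
have g_ge1 n : 1 <= g n by apply: le_trans (D_le n); rewrite exprn_ege1.
have g_gt0 n : 0 < g n by apply: lt_le_trans (g_ge1 n).
have g_sub m n : g (m + n)%N <= g m * g n by apply: gamma_submultiplicative => //; exact: g_gt0.
apply: (@le_trans _ _ D).
  (* [ln] is 0 on nonpositive reals, so that case needs [1 <= D]. *)
  rewrite /Rmax22; have [Gamma_le0|Gamma_gt0] := leP (Gamma22 N) 0.
    by rewrite ln0 // mul0r powRr0.
  by rewrite /powR gt_eqF // divfK ?lnK // gt_eqF // ln_gt0 // ltr1n.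
rewrite /gamma_PPT_inf; apply: limr_ge.
  exact: (@submultiplicative_root_cvg R g g_ge1 g_sub).
apply: nearW => n; rewrite /gamma_PPT_n.
have D_ge0 : 0 <= D by exact: ltW.
(* Writing [D] as a root of its own power reduces the claim to D^(n+1) <= gamma by monotonicity of
   the root. *)
have -> : D = (D ^+ n.+1) `^ (n.+1%:R)^-1.
  by rewrite -powR_mulrn // -powRrM mulfV ?pnatr_eq0 // powRr1.
apply: ge0_ler_powR; rewrite ?nnegrE ?invr_ge0 ?exprn_ge0 //.
exact: ltW (g_gt0 _).
Qed.
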